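(* Let $C\subset\mathbb{R}^N$ ($N\ge2$) be a compact convex set with non-empty interior such that $\partial C$ is $C^{1,1}$, and let $L_\nu$ be the Lipschitz constant of the outward unit normal $\nu$ on $\partial C$. Let $\Omega\in\mathcal{O}_C$ and suppose its thickness function $d:\partial C\to\mathbb{R}_+$ is Lipschitz with constant $K$ and has maximum $M$. If $$K+ML_\nu<1,$$ then the radial map $\Phi:\partial C\to\partial\Omega\setminus C$, $\Phi(c)=c+d(c)\nu(c)$, is bilipschitz.
   Context: A map $\Psi$ is bilipschitz if there exist constants $L_1,L_2>0$ with $L_1\|x-y\|\le\|\Psi(x)-\Psi(y)\|\le L_2\|x-y\|$ for all $x,y$ in its domain (Euclidean distances in $\mathbb{R}^N$). $n(x)$ is the inward unit normal to $\partial\Omega$ at $x$. An open set $\Omega\supset C$ satisfies the $C$-geometric normal property ($C$-GNP) if for every $x\in\partial\Omega\setminus C$ where $n(x)$ exists, the half-line $\{x+t\,n(x):t\ge 0\}$ intersects $C$ and the first intersection point is unique and belongs to $\partial C$. $\mathcal{O}_C$ is the collection of open sets $\Omega\subset\mathbb{R}^N$ such that: (1) $\operatorname{int}(C)\subset\Omega$; (2) $\partial\Omega$ is $C^{1,1}$ outside $C$ and $\partial\Omega\setminus C$ is orientable; (3) for every $c\in\partial C$ the ray $\{c+t\nu(c):t>0\}$ meets $\partial\Omega$ at exactly one point, transversally; (4) $\Omega$ satisfies the $C$-GNP. The thickness function is: $d(c)$ is the unique $t>0$ with $c+t\nu(c)\in\partial\Omega$. *)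

(* Defs.v *)
From HB Require Import structures.
From mathcomp Require Import all_boot all_order all_algebra.
From mathcomp Require Import all_classical all_reals all_analysis.

Set Implicit Arguments.
Unset Strict Implicit.
Unset Printing Implicit Defensive.

Import Order.TTheory GRing.Theory Num.Theory.
Import numFieldNormedType.Exports.

Local Open Scope classical_set_scope.
Local Open Scope ring_scope.

(* R^N is 'rV[R]_N. The norm `|x| of the library on 'rV[R]_N is the maximum
   norm: it is used below only through the topology and the differential
   structure that it induces; every distance is measured by enorm. *)

Definition dot (R : realType) (N : nat) (u v : 'rV[R]_N) : R :=
  \sum_i u 0 i * v 0 i.

Definition enorm (R : realType) (N : nat) (u : 'rV[R]_N) : R :=
  Num.sqrt (dot u u).

Definition boundary (T : topologicalType) (A : set T) : set T :=
  closure A `\` interior A.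

(* L is a Lipschitz constant of f on A, for the Euclidean distance on the
   domain and the norm nrm (enorm or absolute value) on the codomain. *)
Definition lipschitz_with (R : realType) (N : nat) (V : zmodType)
    (nrm : V -> R) (A : set 'rV[R]_N) (f : 'rV[R]_N -> V) (L : R) : Prop :=
  0 <= L /\
  forall x y, A x -> A y -> nrm (f x - f y) <= L * enorm (x - y).

(* L is the Lipschitz constant, that is, the least one. *)
Definition the_lipschitz_constant (R : realType) (N : nat) (V : zmodType)
    (nrm : V -> R) (A : set 'rV[R]_N) (f : 'rV[R]_N -> V) (L : R) : Prop :=
  lipschitz_with nrm A f L /\
  forall L', lipschitz_with nrm A f L' -> L <= L'.

Definition bilipschitz (R : realType) (m n : nat) (A : set 'rV[R]_m)
    (f : 'rV[R]_m -> 'rV[R]_n) : Prop :=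
  exists L1 L2 : R, [/\ 0 < L1, 0 < L2 &
    forall x y, A x -> A y ->
      L1 * enorm (x - y) <= enorm (f x - f y) /\
      enorm (f x - f y) <= L2 * enorm (x - y)].

Definition gradient (R : realType) (N : nat) (h : 'rV[R]_N -> R)
    (x : 'rV[R]_N) : 'rV[R]_N :=
  \row_i 'D_(delta_mx 0 i) h x.

Definition C11_on (R : realType) (N : nat) (U : set 'rV[R]_N)
    (h : 'rV[R]_N -> R) : Prop :=
  (forall x, U x -> differentiable h x) /\
  exists L : R, lipschitz_with (@enorm R N) U (gradient h) L.

(* Near each of its points, S is the graph, over the hyperplane orthogonal to
   a unit vector e, of a C^{1,1} function. This function of N - 1 variables is
   represented by its composition h with the orthogonal projection onto that
   hyperplane, that is, by a function on R^N that does not vary along e. *)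
Definition C11_hypersurface (R : realType) (N : nat) (S : set 'rV[R]_N) :
    Prop :=
  forall x, S x ->
    exists (e : 'rV[R]_N) (h : 'rV[R]_N -> R) (U : set 'rV[R]_N),
      [/\ enorm e = 1,
          forall (y : 'rV[R]_N) (s : R), h (y + s *: e) = h y,
          open U /\ U x,
          C11_on U h &
          forall y, U y -> (S y <-> dot y e = h y)].

(* Tangent vectors are the velocities at x of the curves in S through x. *)
Definition tangent (R : realType) (N : nat) (S : set 'rV[R]_N)
    (x v : 'rV[R]_N) : Prop :=
  exists g : R -> 'rV[R]_N,
    [/\ g 0 = x, \forall t \near (0 : R), S (g t) &
        is_derive (0 : R) (1 : R) g v].

Definition unit_normal (R : realType) (N : nat) (S : set 'rV[R]_N)
    (x n : 'rV[R]_N) : Prop :=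
  enorm n = 1 /\ forall v, tangent S x v -> dot n v = 0.

Definition orientable (R : realType) (N : nat) (S : set 'rV[R]_N) : Prop :=
  exists n : 'rV[R]_N -> 'rV[R]_N,
    {within S, continuous n} /\ forall x, S x -> unit_normal S x (n x).

(* When A lies locally on both sides of its boundary at x, there is no inward
   unit normal at x. *)
Definition inward_unit_normal (R : realType) (N : nat) (A : set 'rV[R]_N)
    (x n : 'rV[R]_N) : Prop :=
  unit_normal (boundary A) x n /\
  \forall t \near (0 : R)^'+, A (x + t *: n) /\ ~ A (x - t *: n).

Definition outward_unit_normal (R : realType) (N : nat) (A : set 'rV[R]_N)
    (x n : 'rV[R]_N) : Prop :=
  inward_unit_normal A x (- n).

Definition first_hit (R : realType) (N : nat) (C : set 'rV[R]_N)
    (x n : 'rV[R]_N) (t : R) : Prop :=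
  [/\ 0 <= t, C (x + t *: n) &
      forall s : R, 0 <= s -> s < t -> ~ C (x + s *: n)].

(* The inclusion of C in Omega is not part of this condition: the class OC
   below only asks that Omega contain the interior of C, so that the boundary
   of Omega may touch C. *)
Definition geometric_normal_property (R : realType) (N : nat)
    (C Omega : set 'rV[R]_N) : Prop :=
  forall x n, (boundary Omega `\` C) x -> inward_unit_normal Omega x n ->
    exists t : R, unique (first_hit C x n) t /\ boundary C (x + t *: n).

(* t is the parameter of a point of the boundary of Omega on the open ray
   from c in the direction n. *)
Definition ray_hits (R : realType) (N : nat) (Omega : set 'rV[R]_N)
    (c n : 'rV[R]_N) (t : R) : Prop :=
  0 < t /\ boundary Omega (c + t *: n).

Definition OC (R : realType) (N : nat) (C Omega : set 'rV[R]_N) : Prop :=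
  [/\ open Omega,
      interior C `<=` Omega,
      C11_hypersurface (boundary Omega `\` C) /\
        orientable (boundary Omega `\` C),
      forall c n, boundary C c -> outward_unit_normal C c n ->
        exists t : R, unique (ray_hits Omega c n) t /\
                      ~ tangent (boundary Omega) (c + t *: n) n &
      geometric_normal_property C Omega].

(* For Omega in OC C, nu the outward unit normal and c in the boundary of C,
   get picks the unique element of this set. *)
Definition thickness (R : realType) (N : nat) (Omega : set 'rV[R]_N)
    (nu : 'rV[R]_N -> 'rV[R]_N) (c : 'rV[R]_N) : R :=
  get [set t : R | ray_hits Omega c (nu c) t].

Definition radial_map (R : realType) (N : nat) (Omega : set 'rV[R]_N)
    (nu : 'rV[R]_N -> 'rV[R]_N) (c : 'rV[R]_N) : 'rV[R]_N :=
  c + thickness Omega nu c *: nu c.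

(* Main.v *)
Require Import Defs.
From HB Require Import structures.
From mathcomp Require Import all_boot all_order all_algebra.
From mathcomp Require Import all_classical all_reals all_analysis.
From mathcomp Require Import ring lra.

Set Implicit Arguments.
Unset Strict Implicit.
Unset Printing Implicit Defensive.

Import Order.TTheory GRing.Theory Num.Theory.
Import numFieldNormedType.Exports.

Local Open Scope classical_set_scope.
Local Open Scope ring_scope.

(* A ray leaving the closed convex set C at c along the outward normal never
   meets C again, since otherwise C would contain the segment in between. As
     Phi x - Phi y = (x - y) + d x (nu x - nu y) + (d x - d y) nu y
   with 0 < d <= M and |nu| = 1, the last two terms have norm at most
   (K + M Lnu) |x - y|, whence the bounds with 1 - (K + M Lnu) > 0 and
   1 + (K + M Lnu). *)

Lemma dot_ge0 (R : realType) (N : nat) (u : 'rV[R]_N) : 0 <= dot u u.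
Proof. by apply: sumr_ge0 => i _; rewrite -expr2 sqr_ge0. Qed.

Lemma dotC (R : realType) (N : nat) (u v : 'rV[R]_N) : dot u v = dot v u.
Proof. by apply: eq_bigr => i _; rewrite mulrC. Qed.

Lemma dot_linear_l (R : realType) (N : nat) (a : R) (u v w : 'rV[R]_N) :
  dot (a *: u + v) w = a * dot u w + dot v w.
Proof.
rewrite /dot mulr_sumr -big_split /=; apply: eq_bigr => i _.
by rewrite !mxE mulrDl mulrA.
Qed.

(** The coefficient [a] is kept free: Cauchy-Schwarz takes the minimiser of this quadratic in [a],
    the triangle inequality takes [a = 1]. *)
Lemma dot_sqD (R : realType) (N : nat) (a : R) (u v : 'rV[R]_N) :
  dot (a *: u + v) (a *: u + v) =
    a ^+ 2 * dot u u + 2 * a * dot u v + dot v v.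
Proof.
rewrite dot_linear_l !(dotC _ (a *: u + v)) !dot_linear_l (dotC v u).
ring.
Qed.

Lemma dot_eq0 (R : realType) (N : nat) (u v : 'rV[R]_N) :
  dot u u = 0 -> dot u v = 0.
Proof.
move=> /eqP; rewrite psumr_eq0; last by move=> i _; rewrite -expr2 sqr_ge0.
move=> /allP u0; apply: big1 => i _.
have := u0 i (mem_index_enum i).
by rewrite /= mulf_eq0 orbb => /eqP ->; rewrite mul0r.
Qed.

Lemma enorm_ge0 (R : realType) (N : nat) (u : 'rV[R]_N) : 0 <= enorm u.
Proof. exact: sqrtr_ge0. Qed.

Lemma sqr_enorm (R : realType) (N : nat) (u : 'rV[R]_N) :
  enorm u ^+ 2 = dot u u.
Proof. by rewrite sqr_sqrtr ?dot_ge0. Qed.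

(** Cauchy-Schwarz, from the nonnegativity of [dot (a *: u + v) (a *: u + v)] as a quadratic in [a].
    The case [dot u u = 0], where it degenerates, is treated first. *)
Lemma dot_le_enorm (R : realType) (N : nat) (u v : 'rV[R]_N) :
  dot u v <= enorm u * enorm v.
Proof.
have [u0|u_neq0] := eqVneq (dot u u) 0.
  by rewrite dot_eq0 // mulr_ge0 ?enorm_ge0.
have u_gt0 : 0 < dot u u by rewrite lt_def u_neq0 dot_ge0.
have discr : dot u v ^+ 2 <= dot u u * dot v v.
  (* The coefficient minimises the quadratic; its minimum is the Gram determinant of [u] and [v]
     divided by [dot u u]. *)
  have := dot_ge0 (- (dot u v / dot u u) *: u + v).
  rewrite dot_sqD.
  have -> : (- (dot u v / dot u u)) ^+ 2 * dot u u +
    2 * - (dot u v / dot u u) * dot u v + dot v v =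
    (dot u u * dot v v - dot u v ^+ 2) / dot u u by field.
  by rewrite pmulr_lge0 ?invr_gt0 // subr_ge0.
apply: le_trans (ler_norm _) _.
by rewrite -sqrtr_sqr /enorm -sqrtrM ?dot_ge0 // ler_wsqrtr.
Qed.

Lemma enormZ (R : realType) (N : nat) (a : R) (u : 'rV[R]_N) :
  enorm (a *: u) = `|a| * enorm u.
Proof.
have -> : enorm (a *: u) = Num.sqrt (a ^+ 2 * dot u u).
  rewrite /enorm /dot mulr_sumr; congr (Num.sqrt _).
  by apply: eq_bigr => i _; rewrite !mxE; ring.
by rewrite sqrtrM ?sqr_ge0 // sqrtr_sqr.
Qed.

Lemma enormN (R : realType) (N : nat) (u : 'rV[R]_N) : enorm (- u) = enorm u.
Proof. by rewrite -scaleN1r enormZ normrN1 mul1r. Qed.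

Lemma ler_enormD (R : realType) (N : nat) (u v : 'rV[R]_N) :
  enorm (u + v) <= enorm u + enorm v.
Proof.
rewrite -(@ler_pXn2r _ 2) ?nnegrE ?addr_ge0 ?enorm_ge0 //.
rewrite sqr_enorm -[u]scale1r dot_sqD scale1r -!sqr_enorm.
have := dot_le_enorm u v; lra.
Qed.

Lemma ler_enormB (R : realType) (N : nat) (u v : 'rV[R]_N) :
  enorm u - enorm v <= enorm (u + v).
Proof.
rewrite lerBlDr -{1}[u](addrK v) -(enormN v); exact: ler_enormD.
Qed.

(** For [t > 0], the point at parameter [s] is the convex combination of [c + t *: n] and [c] with
    weights [s / t] and [1 - s / t]. *)
Lemma convex_set_ray (R : realType) (V : lmodType R) (C : set V) (c n : V)
    (s t : R) :
  convex_set (C : set (convex_lmodType V)) -> 0 <= s -> s <= t ->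
  C c -> C (c + t *: n) -> C (c + s *: n).
Proof.
move=> C_convex s_ge0 s_le_t Cc Ct.
have [t0|t_neq0] := eqVneq t 0.
  suff -> : s = t by [].
  by apply/le_anti; rewrite s_le_t t0.
have t_gt0 : 0 < t by rewrite lt_def t_neq0 (le_trans s_ge0).
have st_ge0 : 0 <= s / t by rewrite divr_ge0 // ltW.
have st_le1 : s / t <= 1 by rewrite ler_pdivrMr // mul1r.
have := C_convex (c + t *: n) c (Itv01 st_ge0 st_le1) (mem_set Ct) (mem_set Cc).
rewrite inE /conv /=.
suff -> : (s / t) *: (c + t *: n) + (1 - s / t) *: c = c + s *: n by [].
by rewrite scalerDr scalerA divfK // scalerBl scale1r addrC addrA subrK.
Qed.

Lemma outward_ray_notin (R : realType) (N : nat) (C : set 'rV[R]_N)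
    (c n : 'rV[R]_N) (t : R) :
  convex_set (C : set (convex_lmodType 'rV[R]_N)) -> C c ->
  outward_unit_normal C c n -> 0 < t -> ~ C (c + t *: n).
Proof.
move=> C_convex Cc [_ near_c] t_gt0 Ct.
(* Outwardness only concerns small parameters, so one is chosen below [t]; convexity then carries
   membership from [t] back to it. *)
have [s [s_le_t s_gt0 [_]]] : exists s, [/\ s <= t, 0 < s &
    C (c + s *: - n) /\ ~ C (c - s *: - n)].
  near (0 : R)^'+ => s; exists s; split; near: s => //.
    exact: nbhs_right_le.
  exact: nbhs_right_gt.
rewrite scalerN opprK; apply.
exact: convex_set_ray C_convex (ltW s_gt0) s_le_t Cc Ct.
Unshelve. all: by end_near.
Qed.

Theorem proposition11p4 (R : realType) (N : nat) (N_ge2 : (2 <= N)%N)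
  (C : set 'rV[R]_N)
  (C_compact : compact C)
  (C_convex : convex_set (C : set (convex_lmodType 'rV[R]_N)))
  (C_interior : interior C !=set0)
  (C_C11 : C11_hypersurface (boundary C))
  (nu : 'rV[R]_N -> 'rV[R]_N)
  (nu_normal : forall c, boundary C c -> outward_unit_normal C c (nu c))
  (Lnu : R)
  (nu_lip : the_lipschitz_constant (@enorm R N) (boundary C) nu Lnu)
  (Omega : set 'rV[R]_N)
  (Omega_OC : OC C Omega)
  (K M : R)
  (d_lip : lipschitz_with Num.norm (boundary C) (thickness Omega nu) K)
  (d_max : (thickness Omega nu @` boundary C) M /\
           ubound (thickness Omega nu @` boundary C) M)
  (small : K + M * Lnu < 1) :
  set_fun (boundary C) (boundary Omega `\` C) (radial_map Omega nu) /\
  bilipschitz (boundary C) (radial_map Omega nu).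
Proof.
have nu1 c : boundary C c -> enorm (nu c) = 1.
  by move=> /nu_normal [[]]; rewrite enormN.
(* [thickness] is a [get], meaningful only on a nonempty set; the ray condition in [OC] provides an
   element. *)
have hits c : boundary C c -> ray_hits Omega c (nu c) (thickness Omega nu c).
  move=> Cc; have [_ _ _ ray _] := Omega_OC.
  have [t [[ht _] _]] := ray c (nu c) Cc (nu_normal c Cc).
  by apply: (@getPex _ [set t | ray_hits Omega c (nu c) t]); exists t.
have C_closed : closed C by apply: compact_closed => //; exact: norm_hausdorff.
split.
  move=> c Cc; have [d_gt0 Omega_c] := hits c Cc; split => //.
  apply: outward_ray_notin (nu_normal c Cc) d_gt0 => //.
  by apply: C_closed; case: Cc.
have [[L_ge0 nuL] _] := nu_lip; have [K_ge0 dK] := d_lip.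
have [[c0 Cc0 d_c0] d_le_M] := d_max.
(* The maximum is attained, hence is itself a thickness and positive. *)
have M_gt0 : 0 < M by rewrite -d_c0; have [] := hits c0 Cc0.
have ML_ge0 : 0 <= M * Lnu by rewrite mulr_ge0 // ltW.
exists (1 - (K + M * Lnu)), (1 + (K + M * Lnu)); split; [lra|lra|].
move=> x y Cx Cy.
set d := thickness Omega nu.
set w := d x *: (nu x - nu y) + (d x - d y) *: nu y.
have -> : radial_map Omega nu x - radial_map Omega nu y = (x - y) + w.
  apply/rowP => i; rewrite /radial_map /w /d !mxE; ring.
have w_le : enorm w <= (K + M * Lnu) * enorm (x - y).
  apply: le_trans (ler_enormD _ _) _.
  (* The variation of [d] accounts for [K]; what remains is the variation of [nu], scaled by [d x],
     which is at most [M]. *)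
  rewrite !enormZ (nu1 y Cy) mulr1 addrC mulrDl lerD ?dK // -mulrA.
  have [d_gt0 _] := hits x Cx.
  rewrite ler_pM ?enorm_ge0 ?nuL // gtr0_norm //.
  by apply: d_le_M; exists x.
have := ler_enormB (x - y) w; have := ler_enormD (x - y) w.
by move=> upper lower; split; lra.
Qed.
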